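(* Let $\mathcal{K}:A\to A$ be an averaging operator on an almost Poisson algebra $(A,\cdot,[\cdot,\cdot])$. Then $(A,\cdot_{\mathcal{K}},\{\cdot,\cdot\}_{\mathcal{K}})$ is an $\mathsf{AWB}$ (algebra with bracket), where $$x\cdot_{\mathcal{K}}y=\mathcal{K}(x)\cdot y,\qquad \{x,y\}_{\mathcal{K}}=[\mathcal{K}(x),y],\qquad x,y\in A.$$
   Context: All vector spaces are finite dimensional over a field $\mathbb{K}$ of characteristic zero. An almost Poisson algebra $(A,\cdot,[\cdot,\cdot])$ is a vector space with a commutative associative bilinear product $\cdot$ and a skew-symmetric bilinear bracket satisfying $[x,y\cdot z]=[x,y]\cdot z+y\cdot[x,z]$ (no Jacobi identity is assumed). An averaging operator on $(A,\cdot,[\cdot,\cdot])$ is a linear map $\mathcal{K}:A\to A$ that is a relative averaging operator with respect to the adjoint representation, i.e. for all $x,y\in A$: $\mathcal{K}(x)\cdot\mathcal{K}(y)=\mathcal{K}(\mathcal{K}(x)\cdot y)$ and $[\mathcal{K}(x),\mathcal{K}(y)]=\mathcal{K}([\mathcal{K}(x),y])$. An $\mathsf{AWB}$ $(B,\cdot,\{\cdot,\cdot\})$ is an associative algebra $(B,\cdot)$ (not necessarily commutative) with a bilinear bracket (not necessarily skew-symmetric) satisfying $\{x,y\cdot z\}=\{x,y\}\cdot z+y\cdot\{x,z\}$ for all $x,y,z\in B$. *)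

(* Defs.v *)
From mathcomp Require Import all_boot all_order all_algebra.
Import GRing.Theory.

Set Implicit Arguments.
Unset Strict Implicit.
Unset Printing Implicit Defensive.

Local Open Scope ring_scope.

(* No Jacobi identity, and [mul] need not have a unit. *)
Record almost_poisson (K : fieldType) (A : vectType K)
    (mul br : A -> A -> A) : Prop := AlmostPoisson {
  ap_mul_bilinear : bilinear_for *:%R *:%R mul;
  ap_mulC : commutative mul;
  ap_mulA : associative mul;
  ap_br_bilinear : bilinear_for *:%R *:%R br;
  ap_br_skew : forall x y, br x y = - br y x;
  ap_leibniz : forall x y z, br x (mul y z) = mul (br x y) z + mul y (br x z)
}.

Record averaging_operator (K : fieldType) (A : vectType K)
    (mul br : A -> A -> A) (f : A -> A) : Prop := AveragingOperator {
  avg_linear : linear f;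
  avg_mul : forall x y, mul (f x) (f y) = f (mul (f x) y);
  avg_br : forall x y, br (f x) (f y) = f (br (f x) y)
}.

(* Neither commutativity of [mul] nor skew-symmetry of [br] is required. *)
Record awb (K : fieldType) (B : vectType K) (mul br : B -> B -> B) : Prop :=
  AWB {
  awb_mul_bilinear : bilinear_for *:%R *:%R mul;
  awb_mulA : associative mul;
  awb_br_bilinear : bilinear_for *:%R *:%R br;
  awb_leibniz : forall x y z, br x (mul y z) = mul (br x y) z + mul y (br x z)
}.

(* Main.v *)
Require Import Defs.
From mathcomp Require Import all_boot all_order all_algebra.

(** Write [f] for the averaging operator.  Its two identities say that
    [f (f x * y) = f x * f y] and [f [f x, y] = [f x, f y]], so the outer [f]
    that appears when the new product or bracket is nested in the left factor
    of a product can be pushed onto its second argument.  After that step,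
    associativity of the new product is associativity of the old one at
    [f x, f y, z], and the Leibniz rule is the old one at the same triple;
    bilinearity survives precomposition of the first argument with a linear
    map. *)

Local Open Scope ring_scope.

Lemma bilinear_precomp_left (K : fieldType) (A : vectType K)
    (op : A -> A -> A) (f : A -> A) :
  linear f -> bilinear_for *:%R *:%R op ->
  bilinear_for *:%R *:%R (fun x y : A => op (f x) y).
Proof.
move=> f_lin [op_linl op_linr]; split=> [y a x x' | x]; last exact: op_linr.
by rewrite f_lin; apply: op_linl.
Qed.

Theorem corollary5p20 (K : fieldType) (charK0 : [pchar K] =i pred0)
    (A : vectType K) (mul br : A -> A -> A) (f : A -> A)
    (hA : almost_poisson mul br) (hf : averaging_operator mul br f) :
  awb (fun x y : A => mul (f x) y) (fun x y : A => br (f x) y).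
Proof.
case: hA => mul_bilin _ mulA br_bilin _ leibniz.
case: hf => f_lin f_mul f_br.
split=> [|x y z||x y z].
- exact: bilinear_precomp_left.
- by rewrite -f_mul mulA.
- exact: bilinear_precomp_left.
- by rewrite -f_br leibniz.
Qed.
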